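(* Let $T$ be a tree on $n\geq 6$ vertices such that $p(T)=q(T)$ and $T$ contains no pendant path $P_3$. Then $$m_{L(T)}(1)\leq \frac{n-6}{4},$$ and equality holds if and only if $T$ is isomorphic to the following tree $T_k$ for some integer $k\geq 0$ (so $n=4k+6$): take vertices $c_0,c_1,\dots,c_k$; attach one pendant vertex to each $c_i$; for each $0\le i\le k-1$ join $c_i$ and $c_{i+1}$ by a path $c_i a_i b_i c_{i+1}$ with two new internal vertices $a_i,b_i$ of degree $2$; finally attach to $c_0$ a pendant path $c_0 x_1 x_2$ and to $c_k$ a pendant path $c_k y_1 y_2$ (new vertices $x_1,x_2,y_1,y_2$, with $x_2,y_2$ pendant). (For $k=0$, $T_0$ is the tree on $6$ vertices consisting of a vertex $c_0$ with one pendant neighbor and two pendant paths of length $2$.)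
   Context: All graphs are finite, simple and undirected. $L(G)=D(G)-A(G)$ is the Laplacian matrix, and $m_{L(G)}(1)$ is the multiplicity of $1$ as an eigenvalue of $L(G)$. A pendant vertex has degree $1$; a quasi-pendant vertex is adjacent to a pendant vertex; $p(G)$, $q(G)$ are the numbers of pendant and quasi-pendant vertices. A pendant path $P_k$ of $G$ means that $G$ is obtained from a graph $G_1$ and a path $P_k$ by joining one end vertex of $P_k$ to a vertex of $G_1$ by an edge. *)

(* Defs.v *)
From HB Require Import structures.
From mathcomp Require Export all_boot all_order all_algebra.
Set Implicit Arguments.
Unset Strict Implicit.
Unset Printing Implicit Defensive.
Import Order.TTheory GRing.Theory Num.Theory.

Definition simple_graph (T : finType) (e : rel T) : Prop :=
  symmetric e /\ irreflexive e.

Definition graph_iso (T1 T2 : finType) (e1 : rel T1) (e2 : rel T2) : Prop :=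
  exists f : T1 -> T2, bijective f /\ forall x y, e1 x y = e2 (f x) (f y).

(* [ucycle] also accepts one vertex with a loop and the two ends of an edge;
   genuine cycles have at least three vertices. *)
Definition acyclic (T : finType) (e : rel T) : Prop :=
  forall c : seq T, 2 < size c -> ~ ucycle e c.

Definition is_tree (T : finType) (e : rel T) : Prop :=
  [/\ simple_graph e, 0 < #|T|, forall x y, connect e x y & acyclic e].

Definition degree (T : finType) (e : rel T) (x : T) : nat := #|[set y | e x y]|.

Definition pendant (T : finType) (e : rel T) (x : T) : bool := degree e x == 1.

Definition quasi_pendant (T : finType) (e : rel T) (x : T) : bool :=
  [exists y, pendant e y && e x y].

Definition num_pendant (T : finType) (e : rel T) : nat :=
  #|[set x | pendant e x]|.

Definition num_quasi_pendant (T : finType) (e : rel T) : nat :=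
  #|[set x | quasi_pendant e x]|.

(* The disjoint union of (T1, e1) and the path 0 - 1 - ... - k-1, with the end
   vertex 0 of the path joined to u. *)
Definition attach_path (T1 : finType) (e1 : rel T1) (u : T1) (k : nat) :
    rel (T1 + 'I_k)%type :=
  fun v w => match v, w with
  | inl x, inl y => e1 x y
  | inl x, inr i | inr i, inl x => (x == u) && (i == 0 :> nat)
  | inr i, inr j => (j == i.+1 :> nat) || (i == j.+1 :> nat)
  end.

Definition has_pendant_path (k : nat) (T : finType) (e : rel T) : Prop :=
  exists (T1 : finType) (e1 : rel T1) (u : T1),
    simple_graph e1 /\ graph_iso e (attach_path e1 u (k := k)).

Section Laplacian.
Local Open Scope ring_scope.
Variable R : comNzRingType.

(* Rows and columns are indexed by the canonical enumeration of the vertices. *)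
Definition degree_mx (T : finType) (e : rel T) : 'M[R]_#|T| :=
  diag_mx (\row_i (degree e (enum_val i))%:R).

Definition adjacency_mx (T : finType) (e : rel T) : 'M[R]_#|T| :=
  \matrix_(i, j) (e (enum_val i) (enum_val j))%:R.

Definition laplacian (T : finType) (e : rel T) : 'M[R]_#|T| :=
  degree_mx e - adjacency_mx e.

End Laplacian.

Definition eigen_mult (F : fieldType) (n : nat) (A : 'M[F]_n) (a : F) : nat :=
  mup a (char_poly A).

(* [TD i] is the pendant vertex attached to [TC i]. *)
Inductive Tk_vertex (k : nat) : Type :=
  | TC of 'I_k.+1 | TD of 'I_k.+1
  | TA of 'I_k | TB of 'I_k
  | TX1 | TX2 | TY1 | TY2.
Arguments TX1 {k}.
Arguments TX2 {k}.
Arguments TY1 {k}.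
Arguments TY2 {k}.

Section TkFinite.
Variable k : nat.

Definition Tk_code (v : Tk_vertex k) :
    ('I_k.+1 + 'I_k.+1 + ('I_k + 'I_k) + 'I_4)%type :=
  match v with
  | TC i => inl (inl (inl i)) | TD i => inl (inl (inr i))
  | TA i => inl (inr (inl i)) | TB i => inl (inr (inr i))
  | TX1 => inr (inord 0) | TX2 => inr (inord 1)
  | TY1 => inr (inord 2) | TY2 => inr (inord 3)
  end.

Definition Tk_decode (c : 'I_k.+1 + 'I_k.+1 + ('I_k + 'I_k) + 'I_4) :
    Tk_vertex k :=
  match c with
  | inl (inl (inl i)) => TC i | inl (inl (inr i)) => TD i
  | inl (inr (inl i)) => TA i | inl (inr (inr i)) => TB i
  | inr j => nth TX1 [:: TX1; TX2; TY1; TY2] j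
  end.

Lemma Tk_codeK : cancel Tk_code Tk_decode.
Proof. by case=> //=; rewrite inordK. Qed.

HB.instance Definition _ := Equality.copy (Tk_vertex k) (can_type Tk_codeK).
HB.instance Definition _ := Choice.copy (Tk_vertex k) (can_type Tk_codeK).
HB.instance Definition _ := Countable.copy (Tk_vertex k) (can_type Tk_codeK).
HB.instance Definition _ := Finite.copy (Tk_vertex k) (can_type Tk_codeK).

Lemma Tk_decodeK : cancel Tk_decode Tk_code.
Proof.
case=> [[[i|i]|[i|i]]|] // [[|[|[|[|j]]]] lt_j] //=;
  by congr inr; apply: val_inj; rewrite /= inordK.
Qed.

Lemma card_Tk : #|{: Tk_vertex k}| = 4 * k + 6.
Proof.
have bij : bijective Tk_code.
  by exists Tk_decode; [exact: Tk_codeK | exact: Tk_decodeK].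
rewrite (bij_eq_card bij) !card_sum !card_ord !addSn !addnS addn0.
by rewrite !mulSn mul0n !addnA !addn0.
Qed.

End TkFinite.

(* Each edge of T_k, in one direction. *)
Definition Tk_arc (k : nat) (v w : Tk_vertex k) : bool :=
  match v, w with
  | TC i, TD j => i == j
  | TC i, TA j => i == j :> nat
  | TA i, TB j => i == j
  | TB i, TC j => j == i.+1 :> nat
  | TC i, TX1 => i == ord0
  | TX1, TX2 => true
  | TC i, TY1 => i == ord_max
  | TY1, TY2 => true
  | _, _ => false
  end.

Definition Tk (k : nat) : rel (Tk_vertex k) :=
  fun v w => Tk_arc v w || Tk_arc w v.

(* Main.v *)
Require Import Defs.
From mathcomp Require Import all_boot all_order all_algebra.
From mathcomp Require Import zify ring.
Set Implicit Arguments.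
Unset Strict Implicit.
Unset Printing Implicit Defensive.
Import Order.TTheory GRing.Theory Num.Theory.

(** Since [L] is symmetric, the multiplicity [m] of [1] is the dimension of the
    space of functions [f] with [L f = f]. Such an [f] vanishes on the set [Q] of
    quasi-pendant vertices, and its values on the pendant vertices are determined
    by the others, so it is given by its values on the set [H] of inner vertices,
    those neither pendant nor quasi-pendant; as [p = q], [n = 2 q + #|H|].

    Root the tree at a quasi-pendant vertex of degree two. Let [B] be the set of
    inner vertices without inner children, [C] the set of inner vertices of
    degree at least three with a quasi-pendant child, and [QQ] the set of
    quasi-pendant vertices with quasi-pendant parent.
    - The equations propagate zeros upwards, so [m <= #|B|]; they also show that
      [f] vanishes when it does on one of the two depth-parity classes of [H], so
      [2 m <= #|H|].
    - Counting quasi-pendant vertices by their parents, [#|B| + #|C| + #|QQ| < q].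
    - Without pendant [P_3], every subtree of an inner vertex meets [C] or [QQ];
      this gives [#|C| + #|QQ| >= 2] unless [#|H| = 1].
    Hence [4 m <= 2 #|B| + #|H| <= n - 2 - 2 (#|C| + #|QQ|) <= n - 6].

    In the equality case [m = #|B|] and [#|H| = 2 #|B|]. The first equality lets
    one interpolate arbitrary values on [B], which forces [H] to consist of
    disjoint pairs of adjacent vertices of degree two; then [C] is empty, [QQ] has
    two elements, and all non-pendant vertices lie on one path from the root. *)

(** * Rooted trees: parents, depths and descendants *)

Definition rooted (T : finType) (e : rel T) (r : T) (par : T -> T) (dep : T -> nat) :=
  [/\ par r = r, dep r = 0, forall x, x != r -> dep x = (dep (par x)).+1 &
      forall x y, e x y = (x != r) && (par x == y) || (y != r) && (par y == x)].

(** Take for [dep x] the length of a shortest walk from [r], and for [par x] the vertex before [x]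
    on such a walk. The parent edges already connect the graph, so acyclicity excludes any other
    edge. *)
Lemma tree_rooted (T : finType) (e : rel T) (r : T) : is_tree e ->
  exists par dep, rooted e r par dep.
Proof.
case=> -[sym_e irr_e] _ conn_e acyc_e.
pose D x n := [exists p : n.-tuple T, path e r p && (last r p == x)].
have DP x n : reflect (exists p, [/\ path e r p, last r p = x & size p = n]) (D x n).
  apply: (iffP existsP) => [[p /andP [rp /eqP px]]|[p [rp px /eqP sp]]].
    by exists p; rewrite size_tuple.
  by exists (Tuple sp); rewrite rp px eqxx.
have [dep depP] : exists dep : T -> nat,
    forall x, D x (dep x) /\ forall n, D x n -> dep x <= n.
  apply: (@fin_all_exists T (fun=> nat)
    (fun x d => D x d /\ forall n, D x n -> d <= n)) => x.
  have exD : exists n, D x n.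
    by have /connectP [p rp px] := conn_e r x; exists (size p); apply/DP; exists p.
  by exists (ex_minn exD); case: ex_minnP.
have [par parP] : exists par : T -> T, forall x, if x == r then par x = r
    else e x (par x) && (dep x == (dep (par x)).+1).
  apply: (@fin_all_exists T (fun=> T) (fun x y => if x == r then y = r
    else e x y && (dep x == (dep y).+1))) => x; case: eqP => [_|ne_xr]; first by exists r.
  have [/DP [p [rp px sp]] min_x] := depP x.
  case/lastP: p rp px sp => [_ /esym|p z]; first by move/ne_xr.
  rewrite rcons_path last_rcons size_rcons => /andP [rp e_pz] eq_zx sp.
  exists (last r p); rewrite -eq_zx sym_e e_pz eq_zx /= eqn_leq -{2}sp ltnS.
  have [/DP [q [rq qp sq]] min_p] := depP (last r p).
  rewrite min_p ?andbT; last by apply/DP; exists p.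
  apply: min_x; apply/DP; exists (rcons q x).
  by rewrite rcons_path rq qp last_rcons size_rcons sq -eq_zx e_pz.
exists par, dep.
have par_r : par r = r by have := parP r; rewrite eqxx.
have e_par x : x != r -> e x (par x).
  by move=> ne_xr; have := parP x; rewrite (negPf ne_xr) => /andP [].
have dep_par x : x != r -> dep x = (dep (par x)).+1.
  by move=> ne_xr; have := parP x; rewrite (negPf ne_xr) => /andP [_ /eqP].
split=> //.
  have [_ min_r] := depP r; apply/eqP; rewrite -leqn0; apply: min_r.
  by apply/DP; exists [::].
pose t := [rel x y | (x != r) && (par x == y) || (y != r) && (par y == x)].
have sym_t : symmetric t by move=> x y; rewrite /= orbC.
have sub_te : subrel t e.
  move=> x y /orP [] /andP [ne_r /eqP <-]; first exact: e_par.
  by rewrite sym_e e_par.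
have conn_r x : connect t x r.
  have [n le_n] := ubnP (dep x); elim: n => // n IH in x le_n *.
  have [->|ne_xr] := eqVneq x r; first exact: connect0.
  apply: (@connect_trans _ _ (par x)); first by rewrite connect1 //= ne_xr eqxx.
  by apply: IH; rewrite -ltnS -dep_par.
move=> x y; apply/idP/idP; last exact: sub_te.
move=> e_xy; apply/negPn/negP => not_t.
have /connectP [p tp py] : connect t x y.
  by apply: connect_trans (conn_r x) _; rewrite (sym_connect_sym sym_t).
case: (shortenP tp) py => q tq uq _ qy.
(* A tree path between the ends of a non-tree edge closes up to a cycle. *)
apply: (acyc_e (x :: q)); last first.
  apply/andP; split=> //=; rewrite rcons_path (sub_path sub_te tq) /=.
  by rewrite -qy sym_e.
case: q tq uq qy => [|z [|z' q]] //=.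
  by move=> _ _ eq_yx; rewrite eq_yx irr_e in e_xy.
by rewrite andbT => t_xz _ eq_yz; rewrite eq_yz in not_t; case/negP: not_t.
Qed.

Section Rooted.
Variables (T : finType) (e : rel T) (r : T) (par : T -> T) (dep : T -> nat).
Hypothesis root_e : rooted e r par dep.

Definition child x : pred T := [pred y | (y != r) && (par y == x)].

Lemma child_par x : x != r -> child (par x) x.
Proof. by move=> ne_xr; apply/andP. Qed.

Lemma childE x y : child x y = (y != r) && (par y == x).
Proof. by []. Qed.

Lemma par_root : par r = r. Proof. by case: root_e. Qed.
Lemma dep_root : dep r = 0. Proof. by case: root_e. Qed.
Lemma dep_par x : x != r -> dep x = (dep (par x)).+1.
Proof. by case: root_e => _ _ + _; apply. Qed.

Lemma rooted_edge x y : e x y = (x != r) && (par x == y) || child x y.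
Proof. by case: root_e => _ _ _; apply. Qed.

Lemma edge_par x : x != r -> e x (par x).
Proof. by rewrite rooted_edge eqxx andbT => ->. Qed.

Lemma edge_child x y : child x y -> e x y.
Proof. by rewrite rooted_edge => ->; rewrite orbT. Qed.

Lemma child_dep x y : child x y -> dep y = (dep x).+1.
Proof. by case/andP => ne_yr /eqP <-; apply: dep_par. Qed.

Lemma child_neq_par x y : child x y -> x != r -> y != par x.
Proof.
move=> xy ne_xr; apply: contra_eq_neq (child_dep xy) => ->.
by rewrite (dep_par ne_xr) neq_ltn ltnS leqW.
Qed.

Lemma degree_rooted x : degree e x = (x != r) + #|[set y | child x y]|.
Proof.
have [->|ne_xr] := eqVneq x r.
  by apply: eq_card => y; rewrite !inE rooted_edge eqxx.
rewrite /degree (cardsD1 (par x)) inE edge_par //; congr (_ + _).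
apply: eq_card => y; rewrite !inE rooted_edge ne_xr /= eq_sym.
case: eqP => //= eq_y; apply/esym/negP => xy.
by have := child_neq_par xy ne_xr; rewrite eq_y eqxx.
Qed.

Lemma dep_eq0 x : (dep x == 0) = (x == r).
Proof. by have [->|/dep_par ->] := eqVneq x r; rewrite ?dep_root. Qed.

Lemma edge_odd_dep x y : e x y -> odd (dep y) = ~~ odd (dep x).
Proof.
rewrite rooted_edge => /orP [/andP [ne_xr /eqP <-]|/child_dep -> //].
by rewrite (dep_par ne_xr) /= negbK.
Qed.

(** As the root is its own parent, iterating past it keeps depth 0, which matches truncated
    subtraction. *)
Lemma dep_iter i x : dep (iter i par x) = dep x - i.
Proof.
elim: i => [|i IH]; first by rewrite subn0.
have [eq_r|/dep_par] := eqVneq (iter i par x) r; last by rewrite IH /=; lia.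
by rewrite iterS eq_r par_root dep_root; move: IH; rewrite eq_r dep_root; lia.
Qed.

(** The reflexive descendant relation: [a] is [x] or an ancestor of [x]. *)
Definition below x a := fconnect par x a.

Lemma below_refl x : below x x. Proof. exact: connect0. Qed.

Lemma below_trans y x z : below x y -> below y z -> below x z.
Proof. exact: connect_trans. Qed.

Lemma below_par x : below x (par x). Proof. exact: fconnect1. Qed.

Lemma below_child x y : child x y -> below y x.
Proof. by case/andP=> _ /eqP <-; apply: below_par. Qed.

Lemma below_iter x a : below x a -> a = iter (dep x - dep a) par x.
Proof.
move/iter_findex; set i := findex _ _ _ => <-.
rewrite dep_iter; have [le_i|lt_i] := leqP i (dep x); first by rewrite subKn.
(* An index beyond the depth has overshot, and both iterates are the root. *)
have /eqP : dep (iter i par x) == 0 by rewrite dep_iter; lia.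
have /eqP : dep (iter (dep x) par x) == 0 by rewrite dep_iter; lia.
move=> /eqP; rewrite dep_eq0 => /eqP eq1 /eqP; rewrite dep_eq0 => /eqP ->.
by rewrite (_ : _ - _ = dep x) ?eq1 //; lia.
Qed.

Lemma below_inj x a b : below x a -> below x b -> dep a = dep b -> a = b.
Proof. by move=> xa xb ab; rewrite (below_iter xa) ab -(below_iter xb). Qed.

Lemma below_dep x a : below x a -> dep a <= dep x.
Proof. by move=> xa; rewrite (below_iter xa) dep_iter; lia. Qed.

Lemma below_iterr i x : below x (iter i par x).
Proof. exact: fconnect_iter. Qed.

Lemma below_parW x a : below x a -> x != a -> below (par x) a.
Proof.
move/iter_findex; case: findex => [/= ->|i <- _]; first by rewrite eqxx.
by rewrite iterSr below_iterr.
Qed.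

Lemma below_root x : below x r.
Proof.
have /eqP : dep (iter (dep x) par x) == 0 by rewrite dep_iter subnn.
by move=> /eqP; rewrite dep_eq0 => /eqP <-; apply: below_iterr.
Qed.

(** Depths are bounded, so the distance to the maximal depth can serve as induction measure. *)
Lemma bottom_up_ind (P : T -> Prop) :
  (forall x, (forall y, dep x < dep y -> P y) -> P x) -> forall x, P x.
Proof.
move=> IHP x; pose N := \max_y dep y.
have [n] := ubnP (N - dep x); elim: n x => // n IH x le_n.
apply: IHP => y lt_xy; apply: IH.
have : dep y <= N by exact: (leq_bigmax y).
by lia.
Qed.

Lemma deepest_below x :
  exists2 y, below y x & forall z, below z x -> dep z <= dep y.
Proof.
by case: (@arg_maxnP _ x (fun y => below y x) dep (below_refl x)) => y; exists y.
Qed.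

Lemma below_children_inj x c c' d :
  child x c -> child x c' -> below d c -> below d c' -> c = c'.
Proof.
move=> xc xc' dc dc'; apply: below_inj dc dc' _.
by rewrite (child_dep xc) (child_dep xc').
Qed.

End Rooted.

(** * Pendant, quasi-pendant and inner vertices of a tree *)

Section PendantVertices.
Variables (T : finType) (e : rel T).
Hypothesis tree_e : is_tree e.
Hypothesis n_gt2 : 2 < #|T|.

Let sym_e : symmetric e. Proof. by case: tree_e => -[]. Qed.
Let irr_e : irreflexive e. Proof. by case: tree_e => -[]. Qed.

Lemma pendant_nbr_uniq x y z : pendant e x -> e x y -> e x z -> y = z.
Proof.
move=> /cards1P [w def_w] xy xz.
have := in_set1 y w; have := in_set1 z w.
by rewrite -def_w !inE xy xz => /esym/eqP -> /esym/eqP.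
Qed.

Lemma degree_gt0 x : 0 < degree e x.
Proof.
have [y ne_yx] : exists y, y != x.
  have : 0 < #|~: [set x]| by rewrite cardsC1; lia.
  by case/card_gt0P => y; rewrite !inE; exists y.
case: tree_e => _ _ /(_ x y) /connectP [[|z p] /= xp py] _.
  by rewrite py eqxx in ne_yx.
by apply/card_gt0P; exists z; rewrite inE; case/andP: xp.
Qed.

(** Two adjacent pendant vertices would form a whole connected component, hence the whole tree. *)
Lemma pendant_adjacent x y : pendant e x -> pendant e y -> ~~ e x y.
Proof.
move=> px py; apply/negP => xy; have yx : e y x by rewrite sym_e.
suff /subset_leq_card : [set: T] \subset [set x; y].
  by rewrite cardsT cards2; move: n_gt2; case: (_ != _) => /=; lia.
apply/subsetP => z _; case: tree_e => _ _ /(_ x z) conn _.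
suff {z conn} cl u v : e u v -> (u \in [set x; y]) = (v \in [set x; y]).
  have cl2 : closed e (mem [set x; y]) by exact: cl.
  by rewrite -(closed_connect cl2 conn) !inE eqxx.
suff {u v} half u v : e u v -> u \in [set x; y] -> v \in [set x; y].
  by move=> uv; apply/idP/idP; apply: half => //; rewrite sym_e.
move=> uv; rewrite !inE => /orP [] /eqP eq_u; rewrite eq_u in uv.
  by rewrite (pendant_nbr_uniq px uv xy) eqxx orbT.
by rewrite (pendant_nbr_uniq py uv yx) eqxx.
Qed.

Lemma quasi_not_pendant x : quasi_pendant e x -> ~~ pendant e x.
Proof.
case/existsP => y /andP [py xy]; apply/negP => px.
by have := pendant_adjacent px py; rewrite xy.
Qed.

Lemma quasi_pendantI u y : pendant e y -> e u y -> quasi_pendant e u.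
Proof. by move=> py uy; apply/existsP; exists y; rewrite py. Qed.

Hypothesis pq : num_pendant e = num_quasi_pendant e.

(** Sending a pendant vertex to its only neighbour maps onto the quasi-pendant vertices; [p = q]
    makes this surjection injective. *)
Lemma pendant_of_quasi_uniq u y z :
  pendant e y -> pendant e z -> e u y -> e u z -> y = z.
Proof.
pose nb x := odflt x [pick y | e x y].
have nbP x w : pendant e x -> e x w -> nb x = w.
  move=> px xw; rewrite /nb; case: pickP => [w' xw'|/(_ w)]; last by rewrite xw.
  exact: pendant_nbr_uniq px xw' xw.
have im_nb : nb @: [set x | pendant e x] = [set x | quasi_pendant e x].
  apply/setP => w; rewrite inE; apply/imsetP/idP => [[x]|/existsP [x /andP [px wx]]].
    rewrite inE => px ->.
    have /card_gt0P [v] := degree_gt0 x; rewrite inE => xv.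
    by apply: (quasi_pendantI px); rewrite (nbP _ _ px xv) sym_e.
  by exists x; rewrite ?inE // (nbP _ w) // sym_e.
have /imset_injP nb_inj : #|nb @: [set x | pendant e x]| == #|[set x | pendant e x]|.
  by rewrite im_nb; apply/eqP.
move=> py pz uy uz; apply: nb_inj; rewrite ?inE //.
by rewrite (nbP y u) ?(nbP z u) // sym_e.
Qed.

Definition inner_vertex x := ~~ pendant e x && ~~ quasi_pendant e x.

Lemma card_vertices : #|T| = (num_quasi_pendant e).*2 + #|[set x | inner_vertex x]|.
Proof.
rewrite -addnn -{1}pq -cardsT -(cardsID [set x | pendant e x] [set: T]) setTI -addnA.
congr (_ + _); rewrite -(cardsID [set x | quasi_pendant e x]); congr (_ + _).
  apply: eq_card => x; rewrite !inE andbT; apply/andP/idP => [[]|qx] //.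
  by rewrite quasi_not_pendant.
by apply: eq_card => x; rewrite !inE /inner_vertex andbT andbC.
Qed.

(** If [z] had degree two, then [z], [u], [y] would be a pendant path joined to the rest at the
    other neighbour of [z]. *)
Lemma no_pendant_path3 u y z : ~ has_pendant_path 3 e ->
  pendant e y -> e u y -> degree e u = 2 -> e u z -> z != y -> degree e z != 2.
Proof.
move=> noP3 py uy du uz ne_zy; apply/negP => /eqP dz; apply: noP3.
have deg2 v a : degree e v = 2 -> e v a ->
    exists2 b, b != a & forall w, e v w = (w == a) || (w == b).
  move=> dv va; have /eqP : #|[set w | e v w] :\ a| = 1.
    by move: dv; rewrite /degree (cardsD1 a) inE va => -[].
  case/cards1P => b def_b; exists b.
    by have := set11 b; rewrite -def_b !inE => /andP [].
  by move=> w; have := in_set1 w b; rewrite -def_b !inE; case: eqP => [->|].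
have eu w : e u w = (w == y) || (w == z).
  have [b _ eu] := deg2 u y du uy; rewrite eu.
  by have := eu z; rewrite uz (negPf ne_zy) /= => /esym/eqP ->.
have zu : e z u by rewrite sym_e.
have [z' ne_z'u ez] := deg2 z u dz zu.
have yu : e y u by rewrite sym_e.
have ey w : e y w = (w == u).
  by apply/idP/eqP => [yw|->//]; apply: pendant_nbr_uniq py yw yu.
have ne_uz : u != z by apply: contraTneq uz => ->; rewrite irr_e.
have ne_uy : u != y by apply: contraTneq uy => ->; rewrite irr_e.
have zz' : e z z' by rewrite ez eqxx orbT.
have ne_zz' : z' != z by apply: contraTneq zz' => ->; rewrite irr_e.
have ne_z'y : z' != y.
  apply: contraTneq zz' => ->; rewrite sym_e ey; rewrite eq_sym //.
(* The path is listed from its attached end, so that [index] in [S] is the position in ['I_3]. *)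
pose S := [:: z; u; y].
have uniqS : uniq S by rewrite /= !inE negb_or (eq_sym z) ne_uz ne_zy ne_uy.
have S'z' : z' \notin S by rewrite !inE !negb_or ne_zz' ne_z'u ne_z'y.
pose T1 := {w | w \notin S}; pose e1 : rel T1 := fun v w => e (val v) (val w).
exists T1, e1, (exist _ z' S'z'); split.
  by split=> [v w|v]; rewrite /e1 ?irr_e // sym_e.
pose f w : T1 + 'I_3 := if insub w is Some w' then inl w' else inr (inord (index w S)).
pose g (v : T1 + 'I_3) := match v with inl w => val w | inr i => nth z S i end.
exists f; split.
  exists g => [w|[w|i]]; rewrite /f /g.
  - case: insubP => [w' _ <- //|]; rewrite negbK => Sw.
    by rewrite inordK ?nth_index // -[3]/(size S) index_mem.
  - by rewrite valK.
  - rewrite insubF; last by apply/negbF; rewrite mem_nth.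
    by rewrite index_uniq // inord_val.
have fS w : w \in S -> f w = inr (inord (index w S)).
  by move=> Sw; rewrite /f insubF // Sw.
have fz : f z = inr (inord 0) by rewrite fS ?inE ?eqxx //= eqxx.
have fu : f u = inr (inord 1).
  by rewrite fS ?inE ?eqxx ?orbT //= eq_sym (negPf ne_uz) eqxx.
have fy : f y = inr (inord 2).
  by rewrite fS ?inE ?eqxx ?orbT //= (negPf ne_zy) (negPf ne_uy) eqxx.
have fV w : w \in S \/ exists2 w', w = val w' & f w = inl w'.
  by rewrite /f; case: insubP => [w' _ <-|]; [right; exists w'|rewrite negbK; left].
have SP w : w \in S -> [\/ w = z, w = u | w = y].
  by rewrite !inE => /or3P [] /eqP ->; [apply: Or31|apply: Or32|apply: Or33].
have nS w : w \notin S -> [/\ (w == z) = false, (w == u) = false & (w == y) = false].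
  by rewrite !inE !negb_or => /and3P [/negPf -> /negPf -> /negPf ->].
have eqs : [/\ (y == z) = false, (z == y) = false, (u == y) = false,
               (y == u) = false & (u == z) = false /\ (z == u) = false].
  rewrite ![y == _]eq_sym ![z == u]eq_sym.
  by rewrite (negPf ne_zy) (negPf ne_uy) (negPf ne_uz).
have eqs' : [/\ (z == z') = false, (u == z') = false & (y == z') = false].
  by rewrite ![_ == z']eq_sym (negPf ne_zz') (negPf ne_z'u) (negPf ne_z'y).
case: eqs => E1 E2 E3 E4 [E5 E6]; case: eqs' => E7 E8 E9.
(* By symmetry of both relations, only pairs whose first vertex is on the path need a
   computation. *)
have half v w : v \in S -> e v w = attach_path e1 (exist _ z' S'z') (f v) (f w).
  move=> Sv; have [Sw|[w' -> fw]] := fV w.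
    by case: (SP _ Sv) => ->; case: (SP _ Sw) => ->; rewrite ?fz ?fu ?fy /=
      ?ez ?eu ?ey ?inordK ?eqxx ?E1 ?E2 ?E3 ?E4 ?E5 ?E6 ?E7 ?E8 ?E9.
  have [N1 N2 N3] := nS _ (valP w').
  by rewrite fw; case: (SP _ Sv) => ->; rewrite ?fz ?fu ?fy /= ?inordK //
    ?ez ?eu ?ey ?N1 ?N2 ?N3 ?andbF ?andbT.
move=> v w; have [/half //|[v' def_v fv]] := fV v.
have [Sw|[w' def_w fw]] := fV w; last by rewrite fv fw def_v def_w.
by rewrite sym_e half // fv; case: (f w) => //= w'; rewrite /e1 sym_e.
Qed.

End PendantVertices.

(** * Algebraic and geometric multiplicity of eigenvalues of symmetric matrices *)

Section SymmetricMultiplicity.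
Local Open Scope ring_scope.

Lemma char_poly_similar (F : fieldType) n (P A B : 'M[F]_n) :
  P \in unitmx -> P *m A = B *m P -> char_poly A = char_poly B.
Proof.
rewrite unitmxE unitfE => detP0 PA; set Pp := map_mx (@polyC F) P.
have PpA : Pp *m char_poly_mx A = char_poly_mx B *m Pp.
  by rewrite /char_poly_mx mulmxBr mulmxBl -!map_mxM PA mul_mx_scalar mul_scalar_mx.
have detPp : \det Pp != 0 by rewrite det_map_mx polyC_eq0.
apply: (mulIf detPp); rewrite -[in RHS]det_mulmx -PpA det_mulmx.
exact: mulrC.
Qed.

Lemma mulmx_tr_eq0 (F : realFieldType) n (v : 'rV[F]_n) : v *m v^T = 0 -> v = 0.
Proof.
move=> /matrixP /(_ 0 0); rewrite !mxE => /eqP.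
under eq_bigr do rewrite mxE -expr2.
rewrite psumr_eq0 => [/allP v0|i _]; last exact: sqr_ge0.
apply/rowP => i; rewrite mxE; apply/eqP.
by have := v0 i (mem_index_enum i); rewrite sqrf_eq0.
Qed.

Lemma char_poly_lblock (F : fieldType) r s (A : 'M[F]_r) (C : 'M_(s, r)) D :
  char_poly (block_mx A 0 C D) = char_poly A * char_poly D.
Proof.
rewrite /char_poly /char_poly_mx map_block_mx map_mx0 -[_%:M]/(_%:M).
by rewrite scalar_mx_block opp_block_mx add_block_mx oppr0 addr0 det_lblock.
Qed.

Lemma char_poly_scalar (F : fieldType) r (a : F) :
  char_poly (a%:M : 'M_r) = ('X - a%:P) ^+ r.
Proof.
rewrite char_poly_trig ?scalar_mx_is_trig //.
by under eq_bigr do rewrite mxE eqxx; rewrite prodr_const card_ord.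
Qed.

(** In a basis of the eigenspace [E] completed by a complement, [A] becomes block triangular with a
    diagonal block [a%:M] of size [\rank E]. The other diagonal block does not have the eigenvalue
    [a]: an eigenvector would give a vector of the complement that lies in [E]. *)
Lemma eigen_mult_symmetric (F : realFieldType) n (A : 'M[F]_n) (a : F) :
  A^T = A -> eigen_mult A a = \rank (kermx (A - a%:M)).
Proof.
move=> symA; set E := kermx _.
(* Replacing [n] by [r + s] gives the blocks literal dimensions. *)
have [r [s [rE nE]]] : exists r s : nat, \rank E = r /\ n = (r + s)%N.
  by exists (\rank E), (n - \rank E)%N; rewrite subnKC ?rank_leq_row.
have [U eqU] : exists U : 'M_(r, n), (U :=: E)%MS.
  by rewrite -rE; exists (row_base E); apply: eq_row_base.
have [V eqV] : exists V : 'M_(s, n), (V :=: E^C)%MS.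
  have <-: \rank E^C%MS = s by rewrite mxrank_compl rE [in LHS]nE addKn.
  by exists (row_base E^C)%MS; apply: eq_row_base.
rewrite rE; move: A symA @E rE U eqU V eqV; subst n => A symA E rE U eqU V eqV.
pose P := col_mx U V.
have uP : P \in unitmx.
  rewrite -row_full_unit; have := addsmx_compl_full E.
  by rewrite /row_full -(adds_eqmx eqU eqV) addsmxE.
have UA0 : U *m (A - a%:M) = 0 by apply/sub_kermxP; rewrite eqU.
have UA : U *m A = a%:M *m U.
  by apply/eqP; rewrite mul_scalar_mx -mul_mx_scalar -subr_eq0 -mulmxBr UA0.
pose M := V *m A *m invmx P.
have VA : V *m A = lsubmx M *m U + rsubmx M *m V.
  by rewrite -mul_row_col hsubmxK mulmxKV.
have PA : P *m A = block_mx a%:M 0 (lsubmx M) (rsubmx M) *m P.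
  by rewrite mul_col_mx UA VA mul_block_col mul0mx addr0.
rewrite /eigen_mult (char_poly_similar uP PA) char_poly_lblock char_poly_scalar.
rewrite mupMl ?mup_XsubCX ?eqxx // -eigenvalue_root_char.
apply/negP => /eigenvalueP [v vD /negP]; apply; apply/eqP.
set w := v *m V.
have wA : w *m (A - a%:M) = v *m lsubmx M *m U.
  rewrite mulmxBr /w -[_ *m V *m A]mulmxA VA mulmxDr !mulmxA vD mul_mx_scalar.
  by rewrite -scalemxAl addrK.
(* The vector [w *m (A - a%:M)] lies in [E], so by symmetry its product with its own transpose is
   zero. *)
have wE : (w <= E)%MS.
  apply/sub_kermxP/mulmx_tr_eq0; rewrite trmx_mul [(_ - _)^T]linearB /= symA tr_scalar_mx.
  by rewrite mulmxA wA -[_ *m U *m _]mulmxA UA0 mulmx0 mul0mx.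
have [y wy] : exists y, w = y *m U by apply/submxP; rewrite eqU.
have /(canRL (mulmxK uP)) : row_mx (- y) v *m P = 0.
  by rewrite mul_row_col mulNmx -wy addNr.
by rewrite mul0mx -[RHS]row_mx0 => /eq_row_mx [].
Qed.

End SymmetricMultiplicity.

(** * Eigenfunctions for the eigenvalue 1 and forcing sets *)

Section EigenFunctions.
Local Open Scope ring_scope.
Variables (F : realFieldType) (T : finType) (e : rel T).

(** The equation [L f = f], solved at each vertex for the sum over its neighbours. *)
Definition lap_fix (f : T -> F) : Prop :=
  forall v, \sum_(w | e v w) f w = (degree e v)%:R * f v - f v.

Local Notation K := (kermx (laplacian F e - 1%:M)).

Definition fun_of_row (v : 'rV[F]_#|T|) : T -> F := fun x => v 0 (enum_rank x).

Hypothesis sym_e : symmetric e.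

Lemma laplacian_sym : (laplacian F e)^T = laplacian F e.
Proof.
apply/matrixP => i j; rewrite !mxE sym_e eq_sym.
by case: eqP => [->|_].
Qed.

Lemma row_lap_fix (v : 'rV_#|T|) :
  (v <= K)%MS <-> lap_fix (fun_of_row v).
Proof.
have E x : (v *m (laplacian F e - 1%:M)) 0 (enum_rank x) =
  (degree e x)%:R * fun_of_row v x - fun_of_row v x
    - \sum_(w | e x w) fun_of_row v w.
  rewrite mulmxBr mulmx1 mulmxBr mul_mx_diag !mxE enum_rankK mulrC.
  rewrite -!addrA; congr (_ + _); rewrite addrC; congr (_ - _).
  rewrite [RHS]big_mkcond [RHS](reindex_onto enum_val enum_rank) /=.
    rewrite /fun_of_row; apply: eq_big => [i|i _]; first by rewrite enum_valK eqxx.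
    by rewrite !mxE enum_rankK enum_valK sym_e; case: ifP; rewrite ?mulr1 ?mulr0.
  by move=> i _; exact: enum_rankK.
split=> [/sub_kermxP vK x|vS].
  by have := E x; rewrite vK mxE => /eqP; rewrite eq_sym subr_eq0 => /eqP.
by apply/sub_kermxP/rowP => i; rewrite -(enum_valK i) E vS subrr mxE.
Qed.

Lemma eigen_mult_lap : eigen_mult (laplacian F e) 1 = \rank K.
Proof. exact/eigen_mult_symmetric/laplacian_sym. Qed.

Let m := eigen_mult (laplacian F e) 1.

Section Forcing.
Variable Z : {set T}.
Hypothesis forceZ : forall f, lap_fix f -> {in Z, forall z, f z = 0} -> forall x, f x = 0.

(** Right multiplication by this matrix restricts a row vector to its coordinates in [Z]. *)
Let S : 'M[F]_(#|T|, #|Z|) := \matrix_(i, j) (enum_val i == enum_val j)%:R.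

Let mulS v j : (v *m S) 0 j = fun_of_row v (enum_val j).
Proof.
rewrite !mxE (bigD1 (enum_rank (enum_val j))) //= big1 ?addr0 => [|i ne_i].
  by rewrite !mxE enum_rankK eqxx mulr1.
rewrite !mxE; case: eqP => [eq_ij|]; last by rewrite mulr0.
by rewrite -eq_ij enum_valK eqxx in ne_i.
Qed.

(** Forcing says that restriction to [Z] is injective on the eigenspace, so it preserves the
    rank. *)
Let rankKS : \rank (K *m S) = m.
Proof.
rewrite /m eigen_mult_lap -[RHS](mxrank_mul_ker K S).
suff ->: (K :&: kermx S)%MS = 0 by rewrite mxrank0 addn0.
apply/eqP; rewrite -submx0; apply/rV_subP => v; rewrite sub_capmx.
case/andP=> /row_lap_fix fv /sub_kermxP vS; rewrite submx0; apply/eqP/rowP => i.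
rewrite mxE -(enum_valK i); apply: (forceZ fv) => z Zz.
by rewrite -(enum_rankK_in Zz Zz) -mulS vS mxE.
Qed.

Lemma eigen_mult_le_forcing : (m <= #|Z|)%N.
Proof. by rewrite -rankKS rank_leq_col. Qed.

(** An injective restriction between spaces of equal dimension is onto, so the indicator of [z] on
    [Z] extends to a fixed function. *)
Lemma forcing_interpolation z : m = #|Z| -> z \in Z ->
  exists f, [/\ lap_fix f, f z = 1 & {in Z, forall y, y != z -> f y = 0}].
Proof.
move=> mZ Zz.
have /row_fullP [D DKS] : row_full (K *m S) by rewrite /row_full rankKS mZ.
set v := row (enum_rank_in Zz z) D *m K.
have vS : v *m S = row (enum_rank_in Zz z) 1%:M.
  by rewrite -mulmxA -row_mul DKS.
exists (fun_of_row v); split; first by apply/row_lap_fix/submxMl.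
  by rewrite -[z in LHS](enum_rankK_in Zz Zz) -mulS vS !mxE eqxx.
move=> y Zy ne_yz; rewrite -[y](enum_rankK_in Zz Zy) -mulS vS !mxE.
case: eqP => // /(congr1 (enum_val)); rewrite !enum_rankK_in // => eq_zy.
by rewrite eq_zy eqxx in ne_yz.
Qed.

End Forcing.

(** Evaluating the family at the points [a j] gives the identity matrix, so the family is
    independent. *)
Lemma eigen_mult_ge_family k (phi : 'I_k -> T -> F) (a : 'I_k -> T) :
    (forall i, lap_fix (phi i)) ->
    (forall i j, phi i (a j) = (i == j)%:R) ->
  (k <= m)%N.
Proof.
move=> fix_phi phi_a; rewrite /m eigen_mult_lap.
pose V : 'M[F]_(k, #|T|) := \matrix_(i, j) phi i (enum_val j).
have VK : (V <= K)%MS.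
  apply/row_subP => i; apply/row_lap_fix => v.
  rewrite /fun_of_row !mxE enum_rankK -fix_phi.
  by apply: eq_bigr => w _; rewrite !mxE enum_rankK.
apply: leq_trans (mxrankS VK).
pose N : 'M[F]_(#|T|, k) := \matrix_(i, j) (enum_val i == a j)%:R.
have VN : V *m N = 1%:M.
  apply/matrixP => i j; rewrite !mxE -phi_a (bigD1 (enum_rank (a j))) //= big1.
    by rewrite !mxE enum_rankK eqxx mulr1 addr0.
  move=> l ne_l; rewrite !mxE; case: eqP => [eq_l|]; last by rewrite mulr0.
  by rewrite -eq_l enum_valK eqxx in ne_l.
by rewrite -[k in (k <= _)%N](mxrank1 F) -VN mxrankM_maxl.
Qed.

End EigenFunctions.

(** * The trees [Tk k] in coordinates, and their eigenfunctions *)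

(* Deleting the pendant vertices of [Tk k] leaves a path; a vertex is coded by
   whether it is pendant and by the position on this path of itself or, if it
   is pendant, of its neighbour. *)
Definition Tk_pos (k : nat) (v : Tk_vertex k) : bool * nat :=
  match v with
  | TC i => (false, 3 * i + 1) | TD i => (true, 3 * i + 1)
  | TA i => (false, 3 * i + 2) | TB i => (false, 3 * i + 3)
  | TX1 => (false, 0) | TX2 => (true, 0)
  | TY1 => (false, 3 * k + 2) | TY2 => (true, 3 * k + 2)
  end.

(** The adjacency relation of a caterpillar in these codes. *)
Definition pos_adj (p q : bool * nat) : bool :=
  [&& ~~ p.1, ~~ q.1 & (p.2 == q.2.+1) || (q.2 == p.2.+1)]
  || (p.1 != q.1) && (p.2 == q.2).

Section TkPositions.
Variable k : nat.
Implicit Types v w : Tk_vertex k.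

Lemma Tk_pos_inj : injective (@Tk_pos k).
Proof.
by case=> [i|i|i|i||||] [j|j|j|j||||] //= [] ?; try (congr (_ _); apply: val_inj => /=);
  try (have := ltn_ord i); try (have := ltn_ord j); lia.
Qed.

Lemma Tk_adj v w : Tk v w = pos_adj (Tk_pos v) (Tk_pos w).
Proof.
case: v => [i|i|i|i||||]; case: w => [j|j|j|j||||];
  rewrite /Tk /pos_adj /= -?val_eqE /= ?orbF ?andbF ?orbT //;
  try (have := ltn_ord i); try (have := ltn_ord j); lia.
Qed.

Lemma Tk_sym : symmetric (@Tk k).
Proof. by move=> v w; rewrite /Tk orbC. Qed.

Lemma degree_TD (i : 'I_k.+1) : degree (@Tk k) (TD i) = 1.
Proof.
rewrite /degree -(cards1 (TC i)); apply: eq_card => w.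
rewrite !inE Tk_adj -(inj_eq Tk_pos_inj) /pos_adj.
by case: w => [j|j|j|j||||] /=; rewrite xpair_eqE /=; lia.
Qed.

Lemma degree_TA (i : 'I_k) : degree (@Tk k) (TA i) = 2.
Proof.
have <- : #|[set TC (widen_ord (leqnSn k) i); TB i]| = 2.
  by rewrite cards2 -(inj_eq Tk_pos_inj) xpair_eqE /=; lia.
apply: eq_card => w; rewrite !inE Tk_adj -!(inj_eq Tk_pos_inj) /pos_adj.
by have := ltn_ord i; case: w => [j|j|j|j||||] /=; rewrite !xpair_eqE /=; lia.
Qed.

Lemma degree_TB (i : 'I_k) : degree (@Tk k) (TB i) = 2.
Proof.
have <- : #|[set TA i; TC (lift ord0 i)]| = 2.
  by rewrite cards2 -(inj_eq Tk_pos_inj) xpair_eqE /= /bump /=; lia.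
apply: eq_card => w; rewrite !inE Tk_adj -!(inj_eq Tk_pos_inj) /pos_adj.
by have := ltn_ord i; case: w => [j|j|j|j||||] /=; rewrite !xpair_eqE /= /bump /=; lia.
Qed.

Local Open Scope ring_scope.
Variable F : realFieldType.

Definition Tk_fixed (i : 'I_k) (v : Tk_vertex k) : F :=
  (v == TA i)%:R + (v == TB i)%:R
  - (v == TD (widen_ord (leqnSn k) i))%:R - (v == TD (lift ord0 i))%:R.

(** At [TA i] and [TB i] the neighbours sum to [1 = 2 * 1 - 1]; at either end of the link the value
    1 of the link cancels the -1 of the pendant vertex, which matches the value 0 there. *)
Lemma Tk_fixed_lap i : lap_fix (@Tk k) (Tk_fixed i).
Proof.
move=> v; rewrite !sumrB big_split /=.
have sum1 w : \sum_(x | Tk v x) (x == w)%:R = (Tk v w)%:R :> F.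
  have [vw|nvw] := boolP (Tk v w).
    by rewrite (bigD1 w) //= eqxx big1 ?addr0 // => x /andP [_ /negPf ->].
  by rewrite big1 // => x vx; case: eqP => // eq_x; rewrite -eq_x vx in nvw.
rewrite !sum1 /Tk_fixed -!(inj_eq Tk_pos_inj).
(* Most positions are told apart by their residues modulo 3. Those of [TY1] and [TA i] are both 2
   modulo 3, and [ki] separates them. *)
have mod3 a b p q : (p %% 3 != q %% 3)%N -> (3 * a + p == 3 * b + q)%N = false by lia.
have ki : (k == i) = false by have := ltn_ord i; lia.
case: v {sum1} => [j|j|j|j||||];
  rewrite ?degree_TD ?degree_TA ?degree_TB /Tk /= !xpair_eqE ?eqn_add2r ?eqn_pmul2l //=
    ?orbF -?val_eqE /= /bump /= ?add1n ?mod3 ?addn1 ?addn2 ?addn3 ?ki //=.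
all: rewrite ?(eq_sym (i : nat)); ring.
Qed.

Lemma Tk_fixed_TA i j : Tk_fixed i (TA j) = (i == j)%:R.
Proof.
rewrite /Tk_fixed -!(inj_eq Tk_pos_inj) !xpair_eqE /= eqn_add2r eqn_pmul2l //.
have -> : (3 * j + 2 == 3 * i + 3)%N = false by lia.
by rewrite val_eqE eq_sym !subr0 addr0.
Qed.

End TkPositions.

(** * Transport along isomorphisms *)

Section Isomorphism.
Local Open Scope ring_scope.
Variables (T1 T2 : finType) (e1 : rel T1) (e2 : rel T2) (f : T1 -> T2).
Hypotheses (bij_f : bijective f) (iso_f : forall x y, e1 x y = e2 (f x) (f y)).

Lemma degree_iso x : degree e1 x = degree e2 (f x).
Proof.
rewrite /degree -(on_card_preimset (onW_bij _ bij_f)).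
by apply: eq_card => y; rewrite !inE iso_f.
Qed.

Lemma lap_fix_iso (F : realFieldType) (phi : T2 -> F) :
  lap_fix e2 phi -> lap_fix e1 (phi \o f).
Proof.
move=> fix_phi x; rewrite degree_iso -fix_phi (reindex f) /=; last exact: onW_bij.
by apply: eq_bigl => y; rewrite iso_f.
Qed.

End Isomorphism.

(** A lower bound is enough here: with the general bound it gives
    [4 * m + 6 <= 4 * k + 6 <= 4 * m + 6]. *)
Lemma mult_iso_Tk (F : realFieldType) (T : finType) (e : rel T) k :
  graph_iso e (@Tk k) ->
  (k <= eigen_mult (laplacian F e) 1)%N /\ #|T| = (4 * k + 6)%N.
Proof.
case=> f [bij_f iso_f]; have [g fK gK] := bij_f; split.
  apply: (@eigen_mult_ge_family _ _ e _ k (fun i => Tk_fixed F i \o f) (g \o @TA k)).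
  - by move=> x y; rewrite !iso_f Tk_sym.
  - by move=> i; apply: lap_fix_iso => //; apply: Tk_fixed_lap.
  - by move=> i j; rewrite /= gK Tk_fixed_TA.
by rewrite (bij_eq_card bij_f) card_Tk.
Qed.

(** * Deepest vertices and the choice of the root *)

Section DeepestVertices.
Variables (T : finType) (e : rel T) (r : T) (par : T -> T) (dep : T -> nat).
Hypotheses (tree_e : is_tree e) (n_gt2 : 2 < #|T|).
Hypothesis root_e : rooted e r par dep.
Local Notation child := (child r par).
Local Notation below := (below par).

Lemma pendant_no_child x y : x != r -> pendant e x -> ~~ child x y.
Proof.
move=> ne_xr /eqP; rewrite (degree_rooted root_e) ne_xr => -[] /eqP.
by rewrite cards_eq0 => /eqP/setP/(_ y); rewrite !inE => /negbT.
Qed.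

Lemma has_child x : (x == r) || ~~ pendant e x -> exists y, child x y.
Proof.
move=> x_r; have := degree_gt0 tree_e n_gt2 x; move: x_r.
rewrite /pendant (degree_rooted root_e); case: eqP => /= _ np gt0.
  by case/card_gt0P: gt0 => y; rewrite inE; exists y.
have /card_gt0P [y] : 0 < #|[set y | child x y]| by lia.
by rewrite inE; exists y.
Qed.

Lemma no_child_pendant x : x != r -> (forall y, ~~ child x y) -> pendant e x.
Proof.
move=> ne_xr no_ch; apply/negPn/negP => np.
have [y xy] : exists y, child x y by apply: has_child; rewrite np orbT.
by have := no_ch y; rewrite xy.
Qed.

Hypothesis pq : num_pendant e = num_quasi_pendant e.

(** A deepest vertex [y] below [x] is pendant, and so are its siblings. By [p = q] there are none,
    so [y] is the only child of its parent. *)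
Lemma deepest_quasi_pendant x : (x == r) || ~~ pendant e x ->
  exists u y, [/\ below u x, pendant e y, child u y & degree e u = (u != r).+1].
Proof.
move=> xP; have [y yx max_y] := deepest_below par dep x.
have no_ch z : below z x -> dep z = dep y -> z != r -> pendant e z.
  move=> zx dz ne_zr; apply: no_child_pendant => // c; apply/negP => zc.
  have := max_y c (below_trans (below_child zc) zx).
  by rewrite (child_dep root_e zc) dz ltnn.
have [c xc] := has_child xP.
have lt_xy : dep x < dep y.
  by rewrite -(child_dep root_e xc) max_y // (below_child xc).
have ne_yx : y != x by apply: contraTneq lt_xy => ->; rewrite ltnn.
have ne_yr : y != r by rewrite -(dep_eq0 root_e); lia.
have uy : child (par y) y by apply: child_par.
have py : pendant e y by apply: no_ch.
have ux : below (par y) x by apply: below_parW.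
exists (par y), y; split=> //.
rewrite (degree_rooted root_e) -addn1; congr (_ + _).
rewrite -[RHS](cards1 y); apply: eq_card => z; rewrite in_set1 inE.
apply/idP/eqP => [uz|->//].
have ne_zr : z != r by case/andP: uz.
apply: (pendant_of_quasi_uniq tree_e n_gt2 pq (u := par y)) => //.
- apply: no_ch ne_zr; first exact: below_trans (below_child uz) ux.
  by rewrite (child_dep root_e uz) (child_dep root_e uy).
- exact: edge_child root_e _ _ uz.
- exact: edge_child root_e _ _ uy.
Qed.

End DeepestVertices.

(** Root the tree anywhere and take the parent of a deepest vertex. If this were the root, its
    degree would be one and two pendant vertices would be adjacent. *)
Lemma quasi_pendant_degree2 (T : finType) (e : rel T) :
    is_tree e -> 2 < #|T| -> num_pendant e = num_quasi_pendant e ->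
  exists2 u, quasi_pendant e u & degree e u = 2.
Proof.
move=> tree_e n_gt2 pq.
have /card_gt0P [r _] : 0 < #|[set: T]| by rewrite cardsT; lia.
have [par [dep root_e]] := tree_rooted r tree_e.
have [|u [y [_ py uy du]]] := deepest_quasi_pendant tree_e n_gt2 root_e pq (x := r).
  by rewrite eqxx.
have e_uy := edge_child root_e uy.
exists u; first exact: quasi_pendantI py e_uy.
have [eq_ur|ne_ur] := eqVneq u r; last by rewrite du ne_ur.
have pu : pendant e u by rewrite /pendant du eq_ur eqxx.
by have := pendant_adjacent tree_e n_gt2 pu py; rewrite e_uy.
Qed.

(** * Counting quasi-pendant vertices by their parents *)

Section Counting.
Variables (T : finType) (e : rel T) (r : T) (par : T -> T) (dep : T -> nat).
Hypotheses (tree_e : is_tree e) (n_gt5 : 5 < #|T|).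
Hypothesis pq : num_pendant e = num_quasi_pendant e.
Hypothesis noP3 : ~ has_pendant_path 3 e.
Hypothesis root_e : rooted e r par dep.
Hypotheses (quasi_r : quasi_pendant e r) (degree_r : degree e r = 2).
Local Notation child := (child r par).
Local Notation below := (below par).
Local Notation inner := (inner_vertex e).
Local Notation H := [set x | inner x].

Let n_gt2 : 2 < #|T|. Proof. lia. Qed.
Let sym_e : symmetric e. Proof. by case: tree_e => -[]. Qed.

Lemma pendant_neq_root y : pendant e y -> y != r.
Proof.
by apply: contraTneq => ->; apply: (quasi_not_pendant tree_e n_gt2).
Qed.

Lemma inner_neq_root x : inner x -> x != r.
Proof. by apply: contraTneq => ->; rewrite /inner_vertex quasi_r andbF. Qed.

Lemma inner_quasi x : inner x -> quasi_pendant e x = false.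
Proof. by case/andP => _ /negPf. Qed.

Lemma quasi_inner x : quasi_pendant e x -> ~~ inner x.
Proof. by move=> qx; rewrite /inner_vertex qx andbF. Qed.

Lemma not_pendantE x : ~~ pendant e x = (inner x) || quasi_pendant e x.
Proof.
rewrite /inner_vertex; case: (boolP (quasi_pendant e x)) => [qx|_].
  by rewrite (quasi_not_pendant tree_e n_gt2 qx).
by rewrite andbT orbF.
Qed.

Lemma par_not_pendant x : x != r -> ~~ pendant e (par x).
Proof.
move=> ne_xr; apply/negP => pp.
have := pendant_no_child root_e x (pendant_neq_root pp) pp.
by rewrite child_par.
Qed.

Lemma inner_nbr x y : inner x -> e x y -> (inner y) || quasi_pendant e y.
Proof.
move=> Hx xy; rewrite -not_pendantE; apply/negP => py.
by have := inner_quasi Hx; rewrite (quasi_pendantI py xy).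
Qed.

Lemma inner_degree x : inner x -> 1 < degree e x.
Proof.
case/andP => np _; have := degree_gt0 tree_e n_gt2 x.
by move: np; rewrite /pendant; lia.
Qed.

Lemma not_pendant_child x : ~~ pendant e x -> exists y, child x y.
Proof. by move=> np; apply: (has_child tree_e n_gt2 root_e); rewrite np orbT. Qed.

Lemma root_not_pendant_child : exists w, [/\ child r w, ~~ pendant e w &
  forall c, child r c -> ~~ pendant e c -> c = w].
Proof.
have [y /andP [py ry]] := existsP quasi_r.
have cy : child r y by move: ry; rewrite (rooted_edge root_e) eqxx.
move: degree_r; rewrite (degree_rooted root_e) eqxx (cardsD1 y) inE cy => -[] /eqP.
case/cards1P => w def_w; exists w.
have := set11 w; rewrite -def_w !inE => /andP [ne_wy /andP [ne_wr /eqP par_w]].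
split; first by rewrite childE ne_wr par_w eqxx.
  apply: contra ne_wy => pw; apply/eqP.
  apply: (pendant_of_quasi_uniq tree_e n_gt2 pq pw py _ ry).
  by rewrite (rooted_edge root_e) childE ne_wr par_w !eqxx.
move=> c rc npc; apply/set1P; rewrite -def_w !inE rc andbT.
by apply: contraNneq npc => ->.
Qed.

Lemma below_root_child w x : child r w -> below w x -> x != r -> x = w.
Proof.
move=> rw wx ne_xr; apply/esym; apply: (below_inj root_e (below_refl par w) wx).
have := below_dep root_e wx; rewrite (child_dep root_e rw) (dep_root root_e).
by have := dep_eq0 root_e x; rewrite (negPf ne_xr); lia.
Qed.

Definition bottoms := [set x | inner x && [forall c, child x c ==> (~~ inner c)]].

Definition quasi_below_inner :=
  [set u | [&& quasi_pendant e u, u != r & inner (par u)]].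

Definition quasi_below_quasi :=
  [set u | [&& quasi_pendant e u, u != r & quasi_pendant e (par u)]].

Definition branchings :=
  [set z | [&& inner z, 2 < degree e z & [exists c, child z c && quasi_pendant e c]]].

Local Notation B := bottoms.
Local Notation QH := quasi_below_inner.
Local Notation QQ := quasi_below_quasi.
Local Notation C := branchings.

Lemma bottomP x : reflect
  (inner x /\ forall c, child x c -> quasi_pendant e c) (x \in B).
Proof.
rewrite inE; apply: (iffP andP) => [[Hx /forallP ch]|[Hx ch]]; split=> //.
  move=> c xc; have := ch c; rewrite xc /= => nHc.
  by have := inner_nbr Hx (edge_child root_e xc); rewrite (negPf nHc).
by apply/forallP => c; apply/implyP => /ch /quasi_inner.
Qed.

(** The successor accounts for the root; the parent of any other quasi-pendant vertex is inner or
    quasi-pendant. *)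
Lemma card_quasi : num_quasi_pendant e = (#|QH| + #|QQ|).+1.
Proof.
rewrite /num_quasi_pendant (cardsD1 r) inE quasi_r add1n; congr _.+1.
rewrite -(cardsID [set u | inner (par u)]); congr (_ + _); apply: eq_card => u.
  by rewrite !inE; case: (u == r); rewrite ?andbF //= andbT.
rewrite !inE; case: (eqVneq u r) => [|ne_ur] /=; rewrite ?andbF //.
have := par_not_pendant ne_ur; rewrite not_pendantE.
by case: (boolP (inner (par u))) => /= [/inner_quasi -> _|_ ->]; rewrite ?andbF ?andbT.
Qed.

(** Group [QH] by parents. All children of a vertex of [B] are in [QH]: there is at least one, and
    at least two if the vertex is also in [C]. A vertex of [C] outside [B] has one by definition. *)
Lemma card_bottoms_branchings : #|B| + #|C| <= #|QH|.
Proof.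
have cardH (A : {set T}) : A \subset H -> #|A| = \sum_(z | inner z) (z \in A).
  move=> /subsetP sAH; rewrite -sum1_card big_mkcond [RHS]big_mkcond.
  apply: eq_bigr => z _; have [/sAH|_] := boolP (z \in A); last by case: ifP.
  by rewrite inE => ->.
rewrite (cardH B) ?(cardH C); last by apply/subsetP => z; rewrite !inE => /andP [].
  rewrite -big_split /= -sum1_card.
  rewrite [leqRHS](partition_big par inner) => [|u]; last by rewrite inE => /and3P [].
  apply: leq_sum => z Hz; rewrite sum1_card.
  have -> : #|[pred u in QH | par u == z]| = #|[set c | child z c && quasi_pendant e c]|.
    apply: eq_card => u; rewrite !inE childE.
    by case: (par u =P z) => [->|_]; rewrite ?andbF // Hz !andbT andbC.
  set S := [set c | _].
  have [Bz|nBz] := boolP (z \in B).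
    have -> : S = [set c | child z c].
      apply/setP => c; rewrite !inE; apply: andb_idr.
      by case/bottomP: Bz => _; apply.
    have := inner_degree Hz; rewrite (degree_rooted root_e) inner_neq_root //.
    case: (boolP (z \in C)) => [|_ /=]; last by lia.
    rewrite inE => /and3P [_ + _].
    by rewrite (degree_rooted root_e) inner_neq_root //=; lia.
  case: (boolP (z \in C)) => // /[!inE] /and3P [_ _ /existsP [c zc]].
  by apply/card_gt0P; exists c; rewrite inE.
by apply/subsetP => z; rewrite !inE => /andP [].
Qed.

(* The parent of a deepest pendant vertex below [x] has degree two, so that
   its own parent cannot be an inner vertex of degree two. *)
Lemma leaf_below x : x != r -> ~~ pendant e x ->
  exists u, [/\ below u x, quasi_pendant e u, u != r &
    quasi_pendant e (par u) \/ inner (par u) /\ 2 < degree e (par u)].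
Proof.
move=> ne_xr npx.
have [|u [y [ux py uy du]]] := deepest_quasi_pendant tree_e n_gt2 root_e pq (x := x).
  by rewrite npx orbT.
have ne_ur : u != r.
  apply: contraNneq ne_xr => eq_ur; rewrite -(dep_eq0 root_e).
  by have := below_dep root_e ux; rewrite eq_ur (dep_root root_e); lia.
have e_uy := edge_child root_e uy.
rewrite ne_ur in du; exists u; split=> //; first exact: quasi_pendantI py e_uy.
have ne_py : par u != y by rewrite eq_sym (child_neq_par root_e uy).
have dp := no_pendant_path3 tree_e noP3 py e_uy du (edge_par root_e ne_ur) ne_py.
have npp := par_not_pendant ne_ur; move: npp (npp).
rewrite {1}not_pendantE => /orP [Hp npp|]; [right|by left].
by split=> //; move: dp (inner_degree Hp); case: (degree e _) => [|[|[]]].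
Qed.

(** The vertex given by [leaf_below] is in [QQ], or its parent is in [C]. That parent is still below
    [x], since a quasi-pendant vertex differs from [x]. *)
Lemma inner_below x : inner x -> exists2 d, d \in C :|: QQ & below d x.
Proof.
move=> Hx; have npx : ~~ pendant e x by rewrite not_pendantE Hx.
have [u [ux qu ne_ur]] := leaf_below (inner_neq_root Hx) npx.
case=> [qp|[Hp dp]].
  by exists u => //; rewrite !inE qu ne_ur qp orbT.
exists (par u).
  rewrite in_setU inE Hp dp; apply/orP; left; apply/existsP; exists u.
  by rewrite child_par.
apply: below_parW ux _; apply: contraTneq qu => ->.
by rewrite (inner_quasi Hx).
Qed.

Lemma root_child_degree w : child r w -> inner w -> 2 < degree e w.
Proof.
move=> rw Hw; have [y /andP [py ry]] := existsP quasi_r.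
have ne_wy : w != y by apply: contraTneq Hw => ->; rewrite /inner_vertex py.
have := no_pendant_path3 tree_e noP3 py ry degree_r (edge_child root_e rw) ne_wy.
by have := inner_degree Hw; lia.
Qed.

(** Let [w] be the non-pendant child of the root. If [w] is in [C] or [QQ], any other inner vertex
    has a second element below it. Otherwise [w] has two inner children, whose disjoint subtrees
    supply one element each. *)
Lemma card_branchings_quasi : #|H| = 1 \/ 1 < #|C| + #|QQ|.
Proof.
have two a b : a \in C :|: QQ -> b \in C :|: QQ -> a != b -> 1 < #|C| + #|QQ|.
  move=> Da Db ne_ab; apply: leq_trans (_ : #|C :|: QQ| <= _); last first.
    by rewrite cardsU leq_subr.
  have <- : #|[set a; b]| = 2 by rewrite cards2 ne_ab.
  by apply/subset_leq_card/subsetP => c /set2P [] ->.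
have [w [rw npw uniq_w]] := root_not_pendant_child.
have ne_wr : w != r by case/andP: rw.
have par_w : par w = r by case/andP: rw => _ /eqP.
have other z : w \in C :|: QQ -> inner z -> z != w -> 1 < #|C| + #|QQ|.
  move=> Dw Hz ne_zw; have [d Dd dz] := inner_below Hz; apply: two Dw Dd _.
  apply: contraNneq ne_zw => eq_wd; rewrite -eq_wd in dz.
  by rewrite (below_root_child rw dz) // inner_neq_root.
have [qw|nqw] := boolP (quasi_pendant e w).
  right; have Dw : w \in C :|: QQ by rewrite !inE qw ne_wr par_w quasi_r orbT.
  have [H0|[z]] := set_0Vmem H; last first.
    rewrite inE => Hz; apply: (other z) => //.
    by apply: contraTneq qw => <-; rewrite (inner_quasi Hz).
  (* Without inner vertices [n] is twice [#|QQ| + 1], and [n >= 6]. *)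
  have := card_vertices tree_e n_gt2 pq; rewrite H0 cards0 card_quasi => cardT.
  suff QH0 : #|QH| = 0 by lia.
  apply/eqP; rewrite cards_eq0; apply/eqP/setP => u.
  by rewrite !inE; have := in_set0 (par u); rewrite -H0 inE => ->; rewrite !andbF.
have Hw : inner w by rewrite /inner_vertex npw.
have dw : 2 < degree e w by apply: root_child_degree.
have [qch|nqch] := boolP [exists c, child w c && quasi_pendant e c].
  have Dw : w \in C :|: QQ by rewrite in_setU inE Hw dw qch.
  have [H0|[z]] := set_0Vmem (H :\ w).
    by left; rewrite (cardsD1 w) H0 cards0 inE Hw.
  by rewrite !inE => /andP [ne_zw Hz]; right; apply: other Dw Hz ne_zw.
right; have ch_inner c : child w c -> inner c.
  move=> wc; have := inner_nbr Hw (edge_child root_e wc).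
  by case/orP=> // qc; case/existsP: nqch; exists c; rewrite wc.
have /card_gt1P [c [c' [/[!inE] wc wc' ne_cc']]] : 1 < #|[set c | child w c]|.
  by move: dw; rewrite (degree_rooted root_e) ne_wr; lia.
have [d Dd dc] := inner_below (ch_inner _ wc).
have [d' Dd' dc'] := inner_below (ch_inner _ wc').
apply: two Dd Dd' _; apply: contra_neq ne_cc' => eq_d.
by apply: (below_children_inj root_e wc wc' dc); rewrite eq_d.
Qed.

(** * Propagation of zeros and upper bounds on the multiplicity *)

Variable F : realFieldType.
Local Notation lap_fix := (@lap_fix F T e).
Local Notation m := (eigen_mult (laplacian F e) 1%R).

Section FixedFunction.
Local Open Scope ring_scope.
Variable f : T -> F.
Hypothesis fix_f : lap_fix f.

Lemma fix_nbr v w : e v w -> (forall x, e v x -> x != w -> f x = 0) ->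
  f w = (degree e v)%:R * f v - f v.
Proof.
move=> vw f0; rewrite -fix_f (bigD1 w) //= big1 ?addr0 // => x /andP [].
exact: f0.
Qed.

Lemma fix_quasi u : quasi_pendant e u -> f u = 0.
Proof.
case/existsP => y /andP [py uy]; have yu : e y u by rewrite sym_e.
rewrite (fix_nbr yu) => [|x yx]; first by rewrite (eqP py) mul1r subrr.
by rewrite (pendant_nbr_uniq py yx yu) eqxx.
Qed.

Lemma fix_isolated x : inner x -> (forall w, e x w -> f w = 0) -> f x = 0.
Proof.
move=> Hx f0; have /eqP := fix_f x; rewrite big1 // eq_sym.
rewrite -[X in _ - X]mul1r -mulrBl mulf_eq0 subr_eq0 pnatr_eq1 => /orP [|/eqP //].
by have := inner_degree Hx; case: (degree e x) => [|[]].
Qed.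

(** The equation at a quasi-pendant vertex determines the value at its only pendant neighbour from
    its non-pendant neighbours. *)
Lemma fix_inner_eq0 : (forall x, inner x -> f x = 0) -> forall x, f x = 0.
Proof.
move=> fH; have np0 x : ~~ pendant e x -> f x = 0.
  by rewrite not_pendantE => /orP [/fH|/fix_quasi].
move=> x; have [px|/np0 //] := boolP (pendant e x).
have /card_gt0P [u] := degree_gt0 tree_e n_gt2 x; rewrite inE => xu.
have ux : e u x by rewrite sym_e.
rewrite (fix_nbr ux) => [|y uy ne_yx].
  by rewrite (fix_quasi (quasi_pendantI px ux)) mulr0 subrr.
apply: np0; apply: contra ne_yx => py.
by rewrite (pendant_of_quasi_uniq tree_e n_gt2 pq py px uy ux).
Qed.

Lemma fix_inner_child c x : child x c -> f c = 0 ->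
  (forall y, child c y -> f y = 0) -> f x = 0.
Proof.
move=> xc fc fy; have cx : e c x by rewrite sym_e (edge_child root_e xc).
rewrite (fix_nbr cx) => [|y]; first by rewrite fc mulr0 subrr.
rewrite (rooted_edge root_e) => /orP [/andP [_ /eqP <-]|/fy //].
by case/andP: xc => _ ->.
Qed.

(** Outside [B] there is an inner child [c]. By induction [f] vanishes at [c] and its children, so
    the equation at [c] forces zero at its parent [x]. *)
Lemma fix_bottoms_below x : inner x ->
  (forall z, z \in B -> below z x -> f z = 0) -> f x = 0.
Proof.
elim/(@bottom_up_ind T dep): x => x IH Hx Bx.
have [xB|nxB] := boolP (x \in B); first exact: Bx xB (below_refl _ _).
have [c xc Hc] : exists2 c, child x c & inner c.
  move: nxB; rewrite inE Hx negb_forall => /existsP [c].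
  by rewrite negb_imply negbK => /andP []; exists c.
have IH_below y : below y c -> inner y -> f y = 0.
  move=> yc Hy; apply: IH Hy _ => [|z zB zy].
    by have := below_dep root_e yc; rewrite (child_dep root_e xc).
  apply: Bx zB _; apply: below_trans zy _.
  exact: below_trans yc (below_child xc).
apply: (fix_inner_child xc (IH_below _ (below_refl _ _) Hc)) => y cy.
have := inner_nbr Hc (edge_child root_e cy).
by case/orP=> [/IH_below|/fix_quasi //]; apply; apply: below_child cy.
Qed.

End FixedFunction.

Lemma mult_le_bottoms : m <= #|B|.
Proof.
apply: eigen_mult_le_forcing => // f fix_f fB; apply: fix_inner_eq0 => // x Hx.
by apply: fix_bottoms_below => // z /fB.
Qed.

(* The inner vertices of a given depth parity are pairwise nonadjacent, so a
   fixed function vanishing on those of the other parity vanishes. *)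
Lemma mult_le_half_inner : m.*2 <= #|H|.
Proof.
pose Hb b := [set x | inner x && (odd (dep x) == b)].
have mHb b : m <= #|Hb b|.
  apply: eigen_mult_le_forcing => // f fix_f fB; apply: fix_inner_eq0 => // x Hx.
  have [ox|ox] := eqVneq (odd (dep x)) b; first by apply: fB; rewrite inE Hx ox eqxx.
  apply: fix_isolated => // w xw; have /orP [Hw|/fix_quasi -> //] := inner_nbr Hx xw.
  apply: fB; rewrite inE Hw (edge_odd_dep root_e xw).
  by case: (odd _) b ox => -[].
have -> : #|H| = #|Hb true| + #|Hb false|.
  rewrite -(cardsID (Hb true) H); congr (_ + _); apply: eq_card => x; rewrite !inE.
    by rewrite andbA andbb.
  by case: (inner x); case: (odd _).
by have := mHb true; have := mHb false; lia.
Qed.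

(** Tightness gives a fixed [f] that is 1 at [z] and 0 on the rest of [B]. The equation at [z] makes
    [f (par z)] nonzero, so [par z] is not quasi-pendant. Below another inner child [c] of [par z]
    the function vanishes, and the equation at [c] would force [f (par z) = 0]. *)
Lemma tight_bottom z : m = #|B| -> z \in B ->
  [/\ inner (par z), forall c, child (par z) c -> inner c -> c = z &
   exists f, [/\ lap_fix f, f z = 1%R & f (par z) = (degree e z)%:R - 1]%R].
Proof.
move=> mB zB; have [Hz chz] := bottomP _ zB; have ne_zr := inner_neq_root Hz.
have [f [fix_f fz f0]] :
    exists f, [/\ lap_fix f, f z = 1%R & {in B, forall y, y != z -> f y = 0%R}].
  apply: forcing_interpolation => // f fix_f fB; apply: fix_inner_eq0 => // x Hx.
  by apply: fix_bottoms_below => // y /fB.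
have fpz : (f (par z) = (degree e z)%:R - 1)%R.
  rewrite (fix_nbr fix_f (edge_par root_e ne_zr)) ?fz ?mulr1 // => x.
  rewrite (rooted_edge root_e) => /orP [/andP [_ /eqP ->]|/chz/fix_quasi -> //].
  by rewrite eqxx.
have fpz0 : f (par z) != 0%R.
  rewrite fpz subr_eq0 pnatr_eq1.
  by have := inner_degree Hz; case: (degree e z) => [|[]].
have Hpz : inner (par z).
  have := inner_nbr Hz (edge_par root_e ne_zr); case/orP=> // qpz.
  by rewrite (fix_quasi fix_f qpz) eqxx in fpz0.
split=> //; last by exists f.
move=> c pzc Hc; apply/eqP; apply: contraNT fpz0 => ne_cz; apply/eqP.
have below_c y : below y c -> inner y -> f y = 0%R.
  move=> yc Hy; apply: fix_bottoms_below => // z' z'B z'y; apply: f0 => //.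
  apply: contra_neq ne_cz => eq_z'; rewrite eq_z' in z'y.
  apply: (below_children_inj root_e pzc (child_par _ ne_zr)).
    exact: below_trans z'y yc.
  exact: below_refl.
apply: (fix_inner_child fix_f pzc (below_c _ (below_refl _ _) Hc)) => y cy.
have := inner_nbr Hc (edge_child root_e cy).
by case/orP=> [/below_c|/(fix_quasi fix_f) //]; apply; apply: below_child cy.
Qed.

(** * Equality case: inner vertices form pairs of degree two *)

Section Tight.
Hypotheses (mB : m = #|B|) (cardH : #|H| = #|B|.*2).

(** On [B] the map [par] is injective with values in [H :\: B], a set of the same size, so it is
    onto. *)
Lemma tight_par u : inner u -> u \notin B -> exists2 z, z \in B & par z = u.
Proof.
move=> Hu nBu.
have par_inj : {in B &, injective par}.
  move=> z z' zB z'B eq_p; have [_ uniq_z' _] := tight_bottom mB z'B.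
  have [Hz _] := bottomP _ zB; have ne_zr := inner_neq_root Hz.
  by apply: uniq_z' Hz; rewrite -eq_p child_par.
have sBH : B \subset H by apply/subsetP => z /bottomP []; rewrite inE.
have sub : par @: B \subset H :\: B.
  apply/subsetP => _ /imsetP [z zB ->]; have [Hp _ _] := tight_bottom mB zB.
  have [Hz _] := bottomP _ zB; have ne_zr := inner_neq_root Hz.
  rewrite inE [_ \in H]inE Hp andbT; apply/negP => /bottomP [_ /(_ z)].
  by rewrite child_par // inner_quasi // => /(_ isT).
have /eqP eqHB : par @: B == H :\: B.
  rewrite eqEcard sub card_in_imset // cardsD (setIidPr sBH) cardH.
  by lia.
have : u \in par @: B by rewrite eqHB inE nBu inE.
by case/imsetP => z zB ->; exists z.
Qed.

(** If [par u] were inner, it would be the parent of some [z] in [B], whose only inner child is [z];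
    then [u = z] would be in [B]. *)
Lemma tight_par_quasi u : inner u -> u \notin B -> quasi_pendant e (par u).
Proof.
move=> Hu nBu; have ne_ur := inner_neq_root Hu.
have /orP [Hp|//] := inner_nbr Hu (edge_par root_e ne_ur).
have nBp : par u \notin B.
  apply/negP => /bottomP [_ /(_ u)].
  by rewrite child_par // inner_quasi // => /(_ isT).
have [z zB par_z] := tight_par Hp nBp; have [_ uniq_z _] := tight_bottom mB zB.
have eq_uz : u = z by apply: uniq_z Hu; rewrite par_z child_par.
by rewrite eq_uz zB in nBu.
Qed.

(** With the function of [tight_bottom], the equation at [par z] says that the two degrees, each
    lowered by one, have product 1. *)
Lemma tight_degree_pair z : z \in B -> degree e z = 2 /\ degree e (par z) = 2.
Proof.
move=> zB; have [Hp uniq_z [f [fix_f fz fp]]] := tight_bottom mB zB.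
have [Hz _] := bottomP _ zB; have ne_zr := inner_neq_root Hz.
have nBp : par z \notin B.
  apply/negP => /bottomP [_ /(_ z)].
  by rewrite child_par // inner_quasi // => /(_ isT).
have e_pz := edge_child root_e (child_par _ ne_zr).
have /eqP : f z = ((degree e (par z))%:R * f (par z) - f (par z))%R.
  apply: fix_nbr => // x; rewrite (rooted_edge root_e).
  case/orP=> [/andP [_ /eqP <-] _|px ne_xz].
    by apply: fix_quasi => //; apply: tight_par_quasi.
  have /orP [Hx|/(fix_quasi fix_f) //] := inner_nbr Hp (edge_child root_e px).
  by rewrite (uniq_z _ px Hx) eqxx in ne_xz.
rewrite fz fp -[X in (_ - X)%R]mul1r -mulrBl.
have := inner_degree Hz; have := inner_degree Hp.
case: (degree e z) => // d; case: (degree e (par z)) => // d' _ _.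
rewrite -!natr1 !addrK -natrM eq_sym pnatr_eq1 muln_eq1.
by case/andP=> /eqP -> /eqP ->.
Qed.

Lemma tight_degree x : inner x -> degree e x = 2.
Proof.
move=> Hx; have [/tight_degree_pair [] //|nBx] := boolP (x \in B).
by have [z /tight_degree_pair [_ <-] ->] := tight_par Hx nBx.
Qed.

End Tight.

(** If [#|H| = 1], then [m = 0] and [n >= 6] suffices; otherwise the counts are added up. *)
Lemma mult_bound : 4 * m + 6 <= #|T|.
Proof.
have := card_vertices tree_e n_gt2 pq; have := card_quasi.
have := card_bottoms_branchings; have := mult_le_bottoms.
have := mult_le_half_inner; have := card_branchings_quasi.
by move: n_gt5; lia.
Qed.

Lemma mult_bound_eq : 4 * m + 6 = #|T| -> [/\ m = #|B|, #|H| = #|B|.*2 & #|QQ| = 2].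
Proof.
move=> eq_m; have cT := card_vertices tree_e n_gt2 pq; have cQ := card_quasi.
have cB := card_bottoms_branchings; have mB := mult_le_bottoms.
have mH := mult_le_half_inner; have cC := card_branchings_quasi.
(* The case [#|H| = 1] is excluded by parity: [m = 0] would give [n = 6], while [n] would be odd. *)
have eqB : m = #|B| by lia.
have eqH : #|H| = #|B|.*2 by lia.
split=> //; suff C0 : #|C| = 0 by lia.
apply/eqP; rewrite cards_eq0; apply/eqP/setP => z; rewrite !inE.
by case: (boolP (inner z)) => // Hz; rewrite tight_degree.
Qed.

(** * Equality case: the tree is some [Tk k] *)

Section Extremal.
Hypothesis eq_m : 4 * m + 6 = #|T|.

Let mB : m = #|B|. Proof. by have [] := mult_bound_eq eq_m. Qed.
Let cardH : #|H| = #|B|.*2. Proof. by have [] := mult_bound_eq eq_m. Qed.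
Let cardQQ : #|QQ| = 2. Proof. by have [] := mult_bound_eq eq_m. Qed.

Lemma below_not_pendant_root_child w x :
    (forall c, child r c -> ~~ pendant e c -> c = w) ->
  x != r -> ~~ pendant e x -> below x w.
Proof.
move=> uniq_w; have [n] := ubnP (dep x); elim: n x => // n IH x lt_n ne_xr npx.
have [px|ne_pr] := eqVneq (par x) r.
  by rewrite (uniq_w x) ?below_refl // childE ne_xr px eqxx.
apply: below_trans (below_par par x) _; apply: IH => //; last exact: par_not_pendant.
by move: lt_n; rewrite (dep_par root_e ne_xr).
Qed.

(** An inner child [w] of the root would have degree above two, so [w] is in [QQ]; let [u] be the
    other element. All inner degrees being two, [leaf_below] finds an element of [QQ] below any
    non-pendant [x] other than the root. If it is [w], then [x = w], and [u] is below it as well. *)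
Lemma extremal_path : exists w u, [/\ child r w, quasi_pendant e w,
  QQ = [set w; u], u != w & forall x, ~~ pendant e x -> below u x].
Proof.
have [w [rw npw uniq_w]] := root_not_pendant_child.
have [ne_wr /eqP par_w] := andP rw.
have qw : quasi_pendant e w.
  move: npw; rewrite not_pendantE => /orP [Hw|//].
  by have := root_child_degree rw Hw; rewrite (tight_degree mB cardH Hw).
have Qw : w \in QQ by rewrite inE qw ne_wr par_w.
have /eqP/cards1P [u def_u] : #|QQ :\ w| = 1.
  by move: cardQQ; rewrite (cardsD1 w) Qw => -[].
have /setD1P [ne_uw Qu] : u \in QQ :\ w by rewrite def_u set11.
have defQQ : QQ = [set w; u] by rewrite -(setD1K Qw) def_u.
exists w, u; split=> // x npx.
have [->|ne_xr] := eqVneq x r; first exact: (below_root root_e).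
have [d [dx qd ne_dr [qp|[Hp dp]]]] := leaf_below ne_xr npx; last first.
  by rewrite (tight_degree mB cardH Hp) in dp.
have : d \in QQ by rewrite inE qd ne_dr.
rewrite defQQ => /set2P [eq_d|<- //]; rewrite eq_d in dx.
rewrite (below_root_child rw dx ne_xr).
move: Qu; rewrite inE => /and3P [qu ne_ur _].
apply: below_not_pendant_root_child => //.
exact: (quasi_not_pendant tree_e n_gt2).
Qed.

Section Spine.
Variables w u : T.
Hypotheses (rw : child r w) (qw : quasi_pendant e w) (defQQ : QQ = [set w; u]).
Hypotheses (ne_uw : u != w) (below_u : forall x, ~~ pendant e x -> below u x).

Let npw : ~~ pendant e w. Proof. exact: (quasi_not_pendant tree_e n_gt2). Qed.
Let Qu : u \in QQ. Proof. by rewrite defQQ set22. Qed.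
Let qu : quasi_pendant e u. Proof. by move: Qu; rewrite inE => /and3P []. Qed.
Let npu : ~~ pendant e u. Proof. exact: (quasi_not_pendant tree_e n_gt2). Qed.
Let dep_w : dep w = 1.
Proof. by rewrite (child_dep root_e rw) (dep_root root_e). Qed.

Lemma spine_inj x y : ~~ pendant e x -> ~~ pendant e y -> dep x = dep y -> x = y.
Proof. by move=> npx npy; apply: (below_inj root_e (below_u npx) (below_u npy)). Qed.

Lemma spine_at i : i <= dep u -> exists2 x, ~~ pendant e x & dep x = i.
Proof.
move=> le_i; exists (iter (dep u - i) par u); last by rewrite (dep_iter root_e) subKn.
elim: (_ - _) => [|j IH] //=.
have [->|ne_r] := eqVneq (iter j par u) r; last exact: par_not_pendant.
by rewrite (par_root root_e) (quasi_not_pendant tree_e n_gt2).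
Qed.

Lemma spine_child x : ~~ pendant e x -> dep x < dep u ->
  exists2 c, child x c & ~~ pendant e c.
Proof.
move=> npx lt_xu; have [c npc dep_c] := spine_at lt_xu; exists c => //.
have ne_cr : c != r by rewrite -(dep_eq0 root_e) dep_c.
rewrite childE ne_cr; apply/eqP; apply: spine_inj (par_not_pendant ne_cr) npx _.
by move: dep_c; rewrite (dep_par root_e ne_cr) => -[].
Qed.

(** Let [c] be the next vertex of the path. If it is quasi-pendant, it lies in [QQ] and is too deep
    to be [w], so it is [u]. Otherwise its parent is not inner, so [c] is the upper vertex of a
    pair; a quasi-pendant [t] follows the pair, three steps below [x]. As [t] has an inner parent,
    it is not [u], and the argument repeats. *)
Lemma spine_period x : quasi_pendant e x -> x != r -> dep x < dep u ->
  exists k, dep u = dep x + 3 * k + 1 /\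
    forall y, ~~ pendant e y -> dep x <= dep y ->
      quasi_pendant e y = ((dep y - dep x) %% 3 == 0) || (dep y == dep u).
Proof.
have [n] := ubnP (dep u - dep x); elim: n x => // n IH x le_n qx ne_xr lt_xu.
have npx := quasi_not_pendant tree_e n_gt2 qx.
have [c xc npc] := spine_child npx lt_xu; have dep_c := child_dep root_e xc.
have [ne_cr /eqP par_c] := andP xc.
have [qc|nqc] := boolP (quasi_pendant e c).
  have Qc : c \in QQ by rewrite inE qc ne_cr par_c.
  have eq_cu : c = u.
    move: Qc; rewrite defQQ => /set2P [eq_cw|//].
    move: dep_c; rewrite eq_cw dep_w => -[/esym/eqP].
    by rewrite (dep_eq0 root_e) (negPf ne_xr).
  exists 0; rewrite -eq_cu dep_c; split=> [|y npy le_xy]; first by rewrite addn0 addn1.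
  have le_yu := below_dep root_e (below_u npy).
  rewrite -eq_cu dep_c in le_yu.
  have [/(spine_inj npy npx) ->|ne_yx] := eqVneq (dep y) (dep x).
    by rewrite qx subnn.
  have eq_y : dep y = dep c by clear - dep_c le_yu le_xy ne_yx; lia.
  by rewrite (spine_inj npy npc eq_y) qc dep_c eqxx orbT.
have Hc : inner c by rewrite /inner_vertex npc.
have nBc : c \notin B.
  apply/negP => /(tight_bottom mB) []; rewrite par_c => Hx.
  by rewrite (inner_quasi Hx) in qx.
have [z zB par_z] := tight_par mB cardH Hc nBc.
have [Hz chz] := bottomP _ zB; have ne_zr := inner_neq_root Hz.
have npz : ~~ pendant e z by rewrite not_pendantE Hz.
have dep_z : dep z = (dep c).+1 by rewrite (dep_par root_e ne_zr) par_z.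
have [t zt] := not_pendant_child npz; have qt := chz t zt.
have npt := quasi_not_pendant tree_e n_gt2 qt.
have [ne_tr /eqP par_t] := andP zt; have dep_t := child_dep root_e zt.
have ne_tu : dep t != dep u.
  apply/eqP => /(spine_inj npt npu) eq_tu; move: Qu; rewrite inE -eq_tu par_t.
  by rewrite (inner_quasi Hz) !andbF.
have le_tu := below_dep root_e (below_u npt).
have [||k [def_u IHt]] := IH t _ qt ne_tr.
- by clear - le_n dep_t dep_z dep_c lt_xu; lia.
- by clear - le_tu ne_tu; lia.
exists k.+1; split=> [|y npy le_xy].
  by clear - def_u dep_t dep_z dep_c; lia.
have [lt_yt|le_ty] := ltnP (dep y) (dep t); last first.
  rewrite IHt //; congr (_ || _).
  by clear - le_ty dep_t dep_z dep_c; lia.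
have [/(spine_inj npy npx) ->|ne_yx] := eqVneq (dep y) (dep x).
  by rewrite qx subnn.
have [eq_yc|ne_yc] := eqVneq (dep y) (dep c).
  by rewrite (spine_inj npy npc eq_yc) (negPf nqc); clear - def_u dep_t dep_z dep_c; lia.
have eq_yz : dep y = dep z.
  by clear - lt_yt le_xy ne_yx ne_yc dep_t dep_z dep_c; lia.
by rewrite (spine_inj npy npz eq_yz) (inner_quasi Hz); clear - def_u dep_t dep_z dep_c; lia.
Qed.

(** The counterpart of [Tk_pos], with depth as position: [r] corresponds to [TX1], [w] to [TC ord0]
    and [u] to [TY1]. *)
Definition vertex_pos x := (pendant e x, if pendant e x then dep (par x) else dep x).

Lemma pendant_edge x y : pendant e y -> e x y = (x == par y).
Proof.
move=> py; have ne_yr := pendant_neq_root py.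
have e_yp := edge_par root_e ne_yr; rewrite sym_e.
by apply/idP/eqP => [yx|-> //]; apply: pendant_nbr_uniq py yx e_yp.
Qed.

Lemma vertex_pos_adj x y : e x y = pos_adj (vertex_pos x) (vertex_pos y).
Proof.
have np_par z : pendant e z -> ~~ pendant e (par z).
  by move=> pz; apply/par_not_pendant/pendant_neq_root.
rewrite /pos_adj /vertex_pos /=; case: ifP => px; case: ifP => py /=.
- by apply/negbTE/(pendant_adjacent tree_e).
- rewrite sym_e pendant_edge //; apply/eqP/eqP => [-> //|eq_d].
  by apply: spine_inj => //; rewrite ?py ?np_par.
- rewrite pendant_edge //; apply/eqP/eqP => [-> //|eq_d].
  by apply: spine_inj => //; rewrite ?px ?np_par.
rewrite orbF (rooted_edge root_e) childE.
apply/idP/idP => [/orP [] /andP [ne_r /eqP <-]|].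
- by rewrite (dep_par root_e ne_r) eqxx.
- by rewrite (dep_par root_e ne_r) eqxx orbT.
have half a b : pendant e a = false -> pendant e b = false ->
    dep a = (dep b).+1 -> (a != r) && (par a == b).
  move=> pa pb dep_a; have ne_ar : a != r by rewrite -(dep_eq0 root_e) dep_a.
  rewrite ne_ar; apply/eqP; apply: spine_inj; rewrite ?par_not_pendant ?pb //.
  by move: dep_a; rewrite (dep_par root_e ne_ar) => -[].
by case/orP=> /eqP /half -> //; rewrite orbT.
Qed.

Lemma spine_iso : exists k, graph_iso e (@Tk k).
Proof.
have [ne_wr _] := andP rw.
have lt_wu : dep w < dep u.
  have le_wu := below_dep root_e (below_u npw).
  have ne_d := contra_neq (@spine_inj u w npu npw) ne_uw.
  by clear - le_wu ne_d; lia.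
have [k [def_u quasiE]] := spine_period qw ne_wr lt_wu.
exists k; rewrite dep_w in def_u quasiE.
have pend_at i : i <= dep u -> [|| i == 0, i == dep u | i %% 3 == 1] ->
    exists2 y, pendant e y & dep (par y) = i.
  move=> le_i i_q; have [x npx dep_x] := spine_at le_i.
  have /existsP [y /andP [py xy]] : quasi_pendant e x.
    have [/eqP|i_gt0] := posnP i; first by rewrite -dep_x (dep_eq0 root_e) => /eqP ->.
    by rewrite quasiE ?dep_x //; clear - i_q i_gt0; lia.
  by exists y => //; move: xy; rewrite pendant_edge // => /eqP <-.
(* Every code of [Tk k] occurs in the tree. The resulting map is injective because the codes are,
   and bijective by cardinality. *)
have [g gP] : exists g : Tk_vertex k -> T, forall v, vertex_pos (g v) = Tk_pos v.
  apply: (@fin_all_exists _ (fun=> T) (fun v x => vertex_pos x = Tk_pos v)) => v.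
  case def_v: (Tk_pos v) => [[] i].
    have [||y py dep_y] := pend_at i.
    - by clear - def_u def_v; case: v def_v => [j|j|j|j||||] //= [] <-;
        try (have := ltn_ord j); lia.
    - by clear - def_u def_v; case: v def_v => [j|j|j|j||||] //= [] <-;
        try (have := ltn_ord j); lia.
    by exists y; rewrite /vertex_pos py dep_y.
  have [|x npx dep_x] := @spine_at i.
    by clear - def_u def_v; case: v def_v => [j|j|j|j||||] //= [] <-;
      try (have := ltn_ord j); lia.
  by exists x; rewrite /vertex_pos (negPf npx) dep_x.
have g_inj : injective g.
  by move=> v v' eq_g; apply: Tk_pos_inj; rewrite -!gP eq_g.
(* Here [p = q = m + 3], so the [3 * m + 3] non-pendant vertices have distinct depths at most
   [dep u = 3 * k + 2]. Hence [m <= k] and [n <= 4 * k + 6]. *)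
have le_T : #|T| <= #|{: Tk_vertex k}|.
  have le_np : #|~: [set x | pendant e x]| <= (dep u).+1.
    rewrite -[leqRHS]card_ord -(@card_in_imset _ _ (fun x => inord (dep x) : 'I_(dep u).+1)).
      exact: max_card.
    move=> x y; rewrite !inE => npx npy /(congr1 val).
    rewrite /= !inordK ?ltnS; first exact: spine_inj.
      exact: below_dep root_e _ _ (below_u npy).
    exact: below_dep root_e _ _ (below_u npx).
  have cP := cardsC [set x | pendant e x]; have cT := card_vertices tree_e n_gt2 pq.
  rewrite card_Tk; move: pq cP cT le_np eq_m cardH mB.
  rewrite /num_pendant; clear - def_u; lia.
have [f gK fK] := inj_card_bij g_inj le_T.
exists f; split; first by exists g.
by move=> x y; rewrite vertex_pos_adj Tk_adj -!gP !fK.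
Qed.

End Spine.

Lemma extremal_iso : exists k, graph_iso e (@Tk k).
Proof. by have [w [u [*]]] := extremal_path; apply: (@spine_iso w u). Qed.

End Extremal.

End Counting.

(** * The bound in rational form and the characterization of equality *)

Local Open Scope ring_scope.

Theorem theorem1p2 (R : rcfType) (T : finType) (e : rel T)
    (tree_e : is_tree e) (n_ge6 : (6 <= #|T|)%N)
    (pq : num_pendant e = num_quasi_pendant e)
    (noP3 : ~ has_pendant_path 3 e) :
  ((eigen_mult (laplacian R e) 1)%:R <= (#|T|%:R - 6) / 4 :> rat) /\
  ((eigen_mult (laplacian R e) 1)%:R = (#|T|%:R - 6) / 4 :> rat <->
   exists k : nat, graph_iso e (@Tk k)).
Proof.
have n_gt2 : (2 < #|T|)%N by exact: leq_trans n_ge6.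
have [r quasi_r degree_r] := quasi_pendant_degree2 tree_e n_gt2 pq.
have [par [dep root_e]] := tree_rooted r tree_e.
have bound := mult_bound tree_e n_ge6 pq noP3 root_e quasi_r degree_r R.
have extremal :=
  @extremal_iso _ _ _ _ _ tree_e n_ge6 pq noP3 root_e quasi_r degree_r R.
set m := eigen_mult _ _ in bound extremal *.
have eqE : m%:R = (#|T|%:R - 6) / 4 :> rat <-> (4 * m + 6 = #|T|)%N.
  split=> [eq_m|<-]; last by rewrite natrD natrM; field.
  by apply/eqP; rewrite -(eqr_nat rat) natrD natrM eq_m; apply/eqP; field.
split; first by rewrite ler_pdivlMr // lerBrDr -natrM -natrD ler_nat mulnC.
rewrite eqE; split=> // -[k /(mult_iso_Tk R)]; rewrite -/m => -[le_km eq_n].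
by move: bound; clear - le_km eq_n; lia.
Qed.
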